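(* Let $G$ be a finite group generated by pseudoreflections on $\mathbb{C}^n$, let $\Omega\subseteq\mathbb{C}^n$ be a bounded $G$-invariant domain and let $\mathcal{H}\subseteq\mathcal{O}(\Omega)$ be an analytic Hilbert module with a $G$-invariant reproducing kernel. Then, for every $\varrho\in\widehat G$ and $1\le i\le\deg\varrho$, $\mathbb{P}_\varrho^{ii}$ is a non-trivial projection on $\mathcal{H}$, that is, $\mathbb{P}_\varrho^{ii}\mathcal{H}\neq\{0\}$.
   Context: A pseudoreflection on $\mathbb{C}^n$ is a linear map $\rho$ of finite order in $GL(n,\mathbb{C})$ such that $I_n-\rho$ has rank $1$. $\Omega$ is $G$-invariant if $\sigma(\Omega)=\Omega$ for all $\sigma\in G$. An analytic Hilbert module $\mathcal{H}\subseteq\mathcal{O}(\Omega)$ (over $\mathbb{C}[\boldsymbol z]=\mathbb{C}[z_1,\ldots,z_n]$) is a Hilbert space of holomorphic functions on $\Omega$ with a reproducing kernel $K:\Omega\times\Omega\to\mathbb{C}$, on which multiplication by each polynomial is a bounded operator, and which contains $\mathbb{C}[\boldsymbol z]$ as a dense subspace. $K$ is $G$-invariant if $K(\sigma\boldsymbol z,\sigma\boldsymbol w)=K(\boldsymbol z,\boldsymbol w)$ for all $\sigma\in G$, $\boldsymbol z,\boldsymbol w\in\Omega$. $\widehat G$ is the set of equivalence classes of irreducible (complex, finite-dimensional) representations of $G$, $\deg\varrho$ is the dimension of $\varrho$. For each $\varrho\in\widehat G$ fix a unitary matrix representation $\boldsymbol\pi_\varrho(\sigma)=(\boldsymbol\pi_\varrho^{ij}(\sigma))_{i,j=1}^{\deg\varrho}$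 in the class $\varrho$. For $f\in\mathcal{H}$, $$\mathbb{P}_\varrho^{ii}f=\frac{\deg\varrho}{|G|}\sum_{\sigma\in G}\boldsymbol\pi_\varrho^{ii}(\sigma^{-1})\,(f\circ\sigma^{-1}).$$ These are orthogonal projections on $\mathcal H$. *)

(* Defs.v *)
From HB Require Import structures.
From mathcomp Require Import all_boot all_order all_algebra.
From mathcomp Require Import all_fingroup mxrepresentation sesquilinear spectral.
From mathcomp Require Import all_classical all_reals all_analysis.
From mathcomp Require Import complex.
From mathcomp Require mpoly.
Set Implicit Arguments.
Unset Strict Implicit.
Unset Printing Implicit Defensive.
Import Order.TTheory GRing.Theory Num.Theory.
Import numFieldNormedType.Exports.
Local Open Scope classical_set_scope.
Local Open Scope ring_scope.

(* The normed-module structures that MathComp-Analysis attaches to a variable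
   numClosedFieldType are not found on R[i] itself. *)
HB.instance Definition _ (R : realType) := PseudoPointedMetric.copy R[i] R[i]^o.
HB.instance Definition _ (R : realType) := NormedModule.copy R[i] R[i]^o.

(* A function on a set [Om] is represented by its extension by zero to C^n
   (written [f \_ Om]), so that equality means equality on [Om]. *)
Notation cfun R n := ('cV[R[i]]_n -> R[i]).

Section Geometry.
Context {R : realType} {n : nat}.

Definition pseudoreflection (M : 'M[R[i]]_n) : Prop :=
  [/\ M \in unitmx, exists2 k, (0 < k)%N & M ^+ k = 1
    & \rank (1%:M - M) = 1%N].

Definition domain (Om : set 'cV[R[i]]_n) : Prop :=
  [/\ open Om, connected Om & Om !=set0].

(* [differentiable] is taken over the scalar field of the normed modules, here
   R[i], so this is complex differentiability. *)
Definition holomorphic_on (Om : set 'cV[R[i]]_n) (f : cfun R n) : Prop :=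
  forall z, Om z -> differentiable f z.

Definition polyfun (p : mpoly.mpoly n R[i]) : cfun R n :=
  fun z => mpoly.meval (fun j => z j ord0) p.

End Geometry.

Definition subsp (R : realType) (n : nat) (H : submodClosed (cfun R n)) : Type :=
  {f : cfun R n | f \in H}.
HB.instance Definition _ (R : realType) (n : nat) (H : submodClosed (cfun R n)) :=
  SubChoice.on (subsp H).
HB.instance Definition _ (R : realType) (n : nat) (H : submodClosed (cfun R n)) :=
  [SubChoice_isSubLmodule of subsp H by <:].

Section Hilbert.
Context {R : realType} {n : nat} {H : submodClosed (cfun R n)}.
(* linear in the first argument, conjugate-linear in the second *)
Variable dot : {dot (subsp H) for Num.conj}.

Definition hnorm (f : subsp H) : R[i] := sqrtC (dot f f).

Definition hilbert_complete : Prop :=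
  forall u : nat -> subsp H,
    (forall e : R[i], 0 < e -> exists N : nat, forall k l : nat,
      (N <= k)%N -> (N <= l)%N -> hnorm (u k - u l) < e) ->
    exists f : subsp H, hnorm (u k - f) @[k --> \oo] --> (0 : R[i]).

Definition reproducing_kernel (Om : set 'cV[R[i]]_n)
    (K : 'cV[R[i]]_n -> 'cV[R[i]]_n -> R[i]) : Prop :=
  forall w, Om w -> exists2 kw : subsp H,
    (forall z, Om z -> \val kw z = K z w) &
    (forall f : subsp H, \val f w = dot f kw).

Record analytic_hilbert_module (Om : set 'cV[R[i]]_n)
    (K : 'cV[R[i]]_n -> 'cV[R[i]]_n -> R[i]) : Prop := AnalyticHilbertModule {
  ahm_restr : forall f : subsp H, \val f \_ Om = \val f;
  ahm_holo : forall f : subsp H, holomorphic_on Om (\val f);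
  ahm_complete : hilbert_complete;
  ahm_kernel : reproducing_kernel Om K;
  ahm_mul : forall p : mpoly.mpoly n R[i],
    exists M : R[i], forall f : subsp H,
      exists2 g : subsp H, \val g = polyfun p \* \val f & hnorm g <= M * hnorm f;
  ahm_poly : forall p : mpoly.mpoly n R[i], polyfun p \_ Om \in H;
  ahm_dense : forall (f : subsp H) (e : R[i]), 0 < e ->
    exists (p : mpoly.mpoly n R[i]) (q : subsp H),
      \val q = polyfun p \_ Om /\ hnorm (f - q) < e
}.

Definition orthogonal_projection (P : {linear subsp H -> subsp H}) : Prop :=
  (forall f, P (P f) = P f) /\ (forall f g, dot (P f) g = dot f (P g)).

End Hilbert.

Section Action.
Context {R : realType} {n : nat} {gT : finGroupType} {G : {group gT}}.
(* [G] acts on C^n by z |-> rho s *m z. *)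
Variable rho : mx_representation R[i] G n.

Definition pseudoreflection_group : Prop :=
  exists2 S : {set gT}, <<S>>%g = G & forall s, s \in S -> pseudoreflection (rho s).

Definition invariant_set (Om : set 'cV[R[i]]_n) : Prop :=
  forall s, s \in G -> (mulmx (rho s)) @` Om = Om.

Definition invariant_kernel (Om : set 'cV[R[i]]_n)
    (K : 'cV[R[i]]_n -> 'cV[R[i]]_n -> R[i]) : Prop :=
  forall s z w, s \in G -> Om z -> Om w -> K (rho s *m z) (rho s *m w) = K z w.

Definition unitary_repr (d : nat) (pi : mx_representation R[i] G d) : Prop :=
  forall s, s \in G -> pi s \is unitarymx.

Definition isotypic_proj (d : nat) (pi : mx_representation R[i] G d) (i : 'I_d)
    (f : cfun R n) : cfun R n :=
  (d%:R / #|G|%:R) *: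
    \sum_(s in G) pi s^-1%g i i *: (f \o mulmx (rho s^-1%g)).

End Action.

(* Main.v *)
Require Import Defs.
From HB Require Import structures.
From mathcomp Require Import all_boot all_order all_algebra.
From mathcomp Require Import all_fingroup mxrepresentation sesquilinear spectral.
From mathcomp Require Import all_classical all_reals all_analysis.
From mathcomp Require Import complex.
From mathcomp Require mpoly.
Import (canonicals) mpoly.
From mathcomp Require Import ring.
Import Order.TTheory GRing.Theory Num.Theory.
Import numFieldNormedType.Exports.
Local Open Scope classical_set_scope.
Local Open Scope ring_scope.

(** The image of [isotypic_proj rho pi i] is nonzero because it already contains
    a nonzero polynomial, and such a polynomial comes from interpolation.  The
    representation [rho] is faithful, so the points fixed by some [s != 1] lie
    in finitely many proper subspaces of C^n and the open set [Om] contains a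
    point [z] with trivial stabilizer ([open_trivial_stabilizer]).  Its
    translates are then pairwise distinct, and some polynomial [p] is 1 at [z]
    and 0 at the other points of the orbit ([interpolating_polynomial]).  In the
    sum that defines the projection of [p], evaluated at [z], only the term of
    the identity survives, and the value is [d / #|G|].

    It remains to see that the formula defines an orthogonal projection of the
    Hilbert module, for which the group has to act on the module unitarily.
    Invariance of the kernel says that translation by [s] sends kernel functions
    to kernel functions ([kernel_translates]).  The functions whose translate
    lies in the module, with the expected inner products, form a closed subspace
    ([translates_closed]); it contains all kernel functions, so only 0 is
    orthogonal to it, and by completeness it is the whole module
    ([closed_subspace_full], [all_translate_unitarily]).  Self-adjointness
    then follows from unitarity of the action and of [pi], and idempotence from
    the orthogonality relations between the matrix entries of an irreducible
    representation ([schur_orthogonality]). *)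

(** * Closed subspaces of a complete inner product space *)

Lemma sqr_normD (C : numClosedFieldType) (a b : C) :
  `|a + b| ^+ 2 <= 2 * `|a| ^+ 2 + 2 * `|b| ^+ 2.
Proof.
rewrite -subr_ge0.
suff -> : 2 * `|a| ^+ 2 + 2 * `|b| ^+ 2 - `|a + b| ^+ 2 = `|a - b| ^+ 2.
  by rewrite exprn_ge0.
have -> : `|a + b| ^+ 2 = (a + b) * (a^* + b^*) by rewrite normCK rmorphD.
have -> : `|a - b| ^+ 2 = (a - b) * (a^* - b^*) by rewrite normCK rmorphB.
by rewrite !normCK; ring.
Qed.

Lemma eq_from_approx (C : numClosedFieldType) (x z : C) :
  (forall e, 0 < e -> exists2 y, `|x - y| ^+ 2 < e & `|y - z| ^+ 2 < e) ->
  x = z.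
Proof.
move=> approx; apply/eqP; rewrite -subr_eq0 -normr_eq0 -sqrf_eq0.
apply/negPn/negP; set c := _ ^+ 2 => nz.
have c0 : 0 < c / 4 by rewrite divr_gt0 // lt_neqAle eq_sym nz exprn_ge0.
have [y xy yz] := approx _ c0.
have : c <= 2 * `|x - y| ^+ 2 + 2 * `|y - z| ^+ 2.
  have cE : c = `|(x - y) + (y - z)| ^+ 2 by rewrite addrA subrK.
  by rewrite cE; exact: sqr_normD.
apply/negP; rewrite -real_ltNge ?realD ?realM ?realX ?normr_real ?realn //.
have -> : c = 2 * (c / 4) + 2 * (c / 4) by field.
by apply: ltrD; rewrite ltr_pM2l.
Qed.

Lemma archi_inv (R : realType) (e : R[i]) : 0 < e ->
  exists N : nat, forall k, (N <= k)%N -> k.+1%:R^-1 < e.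
Proof.
case: e => x y; rewrite ltcE /= => /andP[/eqP -> x0].
exists (Num.truncn x^-1) => k Nk.
have xk : x^-1 < k.+1%:R.
  apply: (lt_le_trans (truncnS_gt _)); by rewrite ler_nat ltnS.
have -> : k.+1%:R^-1 = (k.+1%:R^-1)%:C%C :> R[i] by rewrite fmorphV rmorph_nat.
by rewrite ltcR -[x]invrK ltf_pV2 // posrE ?invr_gt0.
Qed.

Section PreHilbert.
Context {R : realType} {V : lmodType R[i]}.
Variable dot : {dot V for Num.conj}.
Local Notation sqn u := (dot u u).

Lemma dot_conj u v : dot u v = (dot v u)^*.
Proof. by rewrite hermC /= expr0 mul1r. Qed.

Lemma dotBl u v w : dot (u - v) w = dot u w - dot v w.
Proof. by rewrite linearBl. Qed.

Lemma dotBr u v w : dot w (u - v) = dot w u - dot w v.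
Proof. by rewrite linearBr. Qed.

(** The decrease of the squared norm on removing the component along [h] gives
    the Cauchy-Schwarz inequality and, at a near-minimizer of the distance to a
    subspace, near-orthogonality to [h]. *)
Lemma sqn_proj u h : h != 0 ->
  sqn (u - (dot u h / sqn h) *: h) = sqn u - `|dot u h| ^+ 2 / sqn h.
Proof.
move=> h0; set a := dot u h / sqn h.
have hh : sqn h != 0 by rewrite dnorm_eq0.
have oh : dot (u - a *: h) h = 0.
  by rewrite dotBl linearZl_LR /= divfK ?subrr.
rewrite dotBr linearZr_LR /= oh mulr0 subr0 dotBl linearZl_LR /=.
by rewrite (dot_conj h u) normCK /a mulrAC.
Qed.

Lemma cauchy_schwarz u v : `|dot u v| ^+ 2 <= sqn u * sqn v.
Proof.
have [->|v0] := eqVneq v 0.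
  by rewrite !linear0r normr0 expr0n.
have := dnorm_ge0 dot (u - (dot u v / sqn v) *: v).
by rewrite sqn_proj // subr_ge0 ler_pdivrMr // dnorm_gt0.
Qed.

Lemma parallelogram u v : sqn (u - v) = 2 * sqn u + 2 * sqn v - sqn (u + v).
Proof. by rewrite dnormB dnormD; ring. Qed.

Definition sqn_cvg (u : nat -> V) (f : V) := forall e : R[i], 0 < e ->
  exists N : nat, forall k, (N <= k)%N -> sqn (u k - f) < e.

Definition sqn_cauchy (u : nat -> V) := forall e : R[i], 0 < e ->
  exists N : nat, forall k l, (N <= k)%N -> (N <= l)%N -> sqn (u k - u l) < e.

Lemma sqn_cvg_dot {u f} h : sqn_cvg u f -> forall e : R[i], 0 < e ->
  exists N : nat, forall k, (N <= k)%N -> `|dot (u k) h - dot f h| ^+ 2 < e.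
Proof.
move=> uf e e0.
have h1 : 0 < sqn h + 1 by apply: ltr_wpDl => //; exact: dnorm_ge0.
have [N HN] := uf (e / (sqn h + 1)) (divr_gt0 e0 h1).
exists N => k /HN; rewrite ltr_pdivlMr // => lek.
rewrite -dotBl; apply: le_lt_trans lek.
apply: (le_trans (cauchy_schwarz _ _)).
by rewrite mulrDr mulr1 lerDl dnorm_ge0.
Qed.

(** The squared distance is obtained as an infimum of real parts because the
    order of [R[i]] is not total. *)
Lemma dist_inf (D : set V) (f : V) : D 0 ->
  exists2 delta : R[i], (forall m, D m -> delta <= sqn (f - m)) &
    forall e, 0 < e -> exists2 m, D m & sqn (f - m) < delta + e.
Proof.
move=> D0; pose A := [set complex.Re (sqn (f - m)) | m in D].
have sqnR m : sqn m = (complex.Re (sqn m))%:C%C.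
  by rewrite RRe_real // ger0_real // dnorm_ge0.
have hA : has_inf A.
  split; first by exists (complex.Re (sqn (f - 0))); exists 0.
  by exists 0 => _ [m _ <-]; rewrite -lecR -sqnR dnorm_ge0.
exists (inf A)%:C%C => [m Dm|e e0].
  by rewrite sqnR lecR; apply: ge_inf; [exact: hA.2|exists m].
have eR : e = (complex.Re e)%:C%C by rewrite RRe_real // gtr0_real.
have e0' : 0 < complex.Re e by rewrite -ltcR -eR.
have [_ [m Dm <-] lt] := inf_adherent e0' hA.
by exists m => //; rewrite sqnR eR -rmorphD ltcR.
Qed.

(** The projection theorem, in the form: a closed subspace of a complete space
    is everything if only 0 is orthogonal to it.  Elements of [D] that nearly
    minimize the distance to [f] form a Cauchy sequence, by the parallelogram
    law, and [f] minus its limit is orthogonal to [D]. *)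
Lemma closed_subspace_full (D : set V) :
  (forall u, sqn_cauchy u -> exists f, sqn_cvg u f) ->
  D 0 -> (forall u v, D u -> D v -> D (u + v)) ->
  (forall (a : R[i]) u, D u -> D (a *: u)) ->
  (forall u f, (forall k, D (u k)) -> sqn_cvg u f -> D f) ->
  (forall f, (forall h, D h -> dot f h = 0) -> f = 0) ->
  forall f, D f.
Proof.
move=> Vcomplete D0 DD DZ Dcl Dperp f.
have [delta dle dadh] := dist_inf D f D0.
have i0 k : (0 : R[i]) < k.+1%:R^-1 by rewrite invr_gt0 ltr0n.
have /choice [m mP] k : exists m, D m /\ sqn (f - m) < delta + k.+1%:R^-1.
  by have [m ? ?] := dadh _ (i0 k); exists m.
have mD k := (mP k).1; have {mP}mlt k := (mP k).2.
have mdist k l : sqn (m k - m l) < 2 * k.+1%:R^-1 + 2 * l.+1%:R^-1.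
  have -> : m k - m l = (f - m l) - (f - m k).
    by rewrite opprB [RHS]addrC addrA subrK.
  rewrite parallelogram.
  (* The sum is twice the difference between f and the midpoint, and the
     midpoint is in D, hence at squared distance at least delta. *)
  have -> : (f - m l) + (f - m k) = 2 *: (f - 2^-1 *: (m k + m l)).
    rewrite scalerBr scalerA divff ?pnatr_eq0 // scale1r.
    by rewrite scaler_nat mulr2n opprD [- m k - m l]addrC addrACA.
  rewrite dnormZ normr_nat.
  have := dle _ (DZ 2^-1 _ (DD _ _ (mD k) (mD l))).
  set s := sqn (f - _); move: (mlt k) (mlt l).
  set x := sqn _; set y := sqn _ => h1 h2 h3.
  have : 2 * (y + x) < 2 * (delta + l.+1%:R^-1 + (delta + k.+1%:R^-1)).
    by rewrite ltr_pM2l ?ltr0n // ltrD.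
  have : (2 ^+ 2) * delta <= (2 ^+ 2) * s.
    by rewrite ler_pM2l // exprn_gt0.
  move=> h4 h5; rewrite -mulrDr ltrBlDr; apply: lt_le_trans h5 _.
  apply: le_trans (lerD (lexx _) h4); rewrite le_eqVlt.
  by apply/orP; left; apply/eqP; ring.
have [g mg] : exists g, sqn_cvg m g.
  apply: Vcomplete => e e0.
  have e4 : 0 < e / 4 by rewrite divr_gt0.
  have [N HN] := archi_inv _ _ e4; exists N => k l Nk Nl.
  apply: lt_trans (mdist k l) _.
  have -> : e = 2 * (e / 4) + 2 * (e / 4) by field.
  by apply: ltrD; rewrite ltr_pM2l // HN.
have Dg := Dcl _ _ mD mg.
suff -> : f = g by [].
apply/eqP; rewrite -subr_eq0; apply/eqP; apply: Dperp => h Dh.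
have [->|h0] := eqVneq h 0; first by rewrite linear0r.
have hh : 0 < sqn h by rewrite dnorm_gt0.
(* Moving the near-minimizer m k along h cannot gain more than its excess
   over delta; the best such move gains |<f - m k, h>|^2 / |h|^2. *)
have orth k : `|dot (f - m k) h| ^+ 2 < sqn h * k.+1%:R^-1.
  set a := dot (f - m k) h / sqn h.
  have := dle _ (DD _ _ (mD k) (DZ a _ Dh)).
  rewrite opprD addrA sqn_proj // lerBrDr => le1.
  have := le_lt_trans le1 (mlt k).
  by rewrite ltrD2l ltr_pdivrMr // mulrC.
rewrite dotBl; apply/eqP; rewrite subr_eq0; apply/eqP/eq_from_approx => e e0.
have [N1 H1] := sqn_cvg_dot h mg _ e0.
have [N2 H2] := archi_inv _ _ (divr_gt0 e0 hh).
pose k := maxn N1 N2; exists (dot (m k) h); last exact/H1/leq_maxl.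
have := H2 k (leq_maxr _ _); rewrite -dotBl ltr_pdivlMr // mulrC.
exact: lt_trans (orth k).
Qed.

Lemma sqn_cvg_cauchy u f : sqn_cvg u f -> sqn_cauchy u.
Proof.
move=> uf e e0; have [N HN] := uf (e / 4) (divr_gt0 e0 (ltr0Sn _ _)).
exists N => k l /HN Hk /HN Hl.
have -> : u k - u l = (u k - f) - (u l - f) by rewrite opprB addrA subrK.
rewrite parallelogram.
apply: (@le_lt_trans _ _ (2 * sqn (u k - f) + 2 * sqn (u l - f))).
  by rewrite gerBl dnorm_ge0.
have -> : e = 2 * (e / 4) + 2 * (e / 4) by field.
by apply: ltrD; rewrite ltr_pM2l.
Qed.

Lemma dot_lim_unique u f v g h h' : sqn_cvg u f -> sqn_cvg v g ->
  (forall k, dot (u k) h = dot (v k) h') -> dot f h = dot g h'.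
Proof.
move=> uf vg uv; apply: eq_from_approx => e e0.
have [N1 H1] := sqn_cvg_dot h uf _ e0.
have [N2 H2] := sqn_cvg_dot h' vg _ e0.
pose k := maxn N1 N2; exists (dot (u k) h).
  by rewrite distrC; exact/H1/leq_maxl.
by rewrite uv; exact/H2/leq_maxr.
Qed.
End PreHilbert.

(** * Orthogonality of matrix entries *)

(** Averaging the elementary matrix [delta_mx j k] over conjugation by the group
    gives a matrix that commutes with [pi], hence a scalar by Schur's lemma, and
    the trace determines which one. *)
Lemma schur_orthogonality (C : numClosedFieldType) (gT : finGroupType)
    (G : {group gT}) (d : nat) (pi : mx_representation C G d) (i j k l : 'I_d) :
  mx_irreducible pi ->
  \sum_(s in G) pi s i j * pi s^-1%g k l
    = #|G|%:R / d%:R * (j == k)%:R * (i == l)%:R.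
Proof.
move=> irr; pose A := \sum_(s in G) pi s *m delta_mx j k *m pi s^-1%g.
have AC : centgmx pi A.
  apply/centgmxP => x xG; rewrite /A mulmx_suml mulmx_sumr.
  rewrite (reindex_inj (mulgI x)) /=.
  apply: eq_big => [t|t]; rewrite groupMl // => tG.
  by rewrite invMg !repr_mxM ?groupV // -!mulmxA -repr_mxM ?groupV //
    mulVg repr_mx1 mulmx1.
have /is_scalar_mxP[c Ac] : is_scalar_mx A.
  apply: mx_abs_irr_cent_scalar AC.
  exact: (@group_closure_closed_field C gT G d pi irr).
have d0 : (d%:R : C) != 0.
  by case/mx_irrP: irr => d0 _; rewrite pnatr_eq0 -lt0n.
have trA : \tr A = #|G|%:R * (j == k)%:R.
  rewrite /A raddf_sum /= (eq_bigr (fun=> (j == k)%:R)) => [|s sG].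
    by rewrite sumr_const mulr_natl.
  rewrite -mulmxA mxtrace_mulC -mulmxA -repr_mxM ?groupV //.
  rewrite mulVg repr_mx1 mulmx1.
  rewrite /mxtrace (bigD1 j) //= big1 => [|h /negPf hj]; rewrite mxE ?hj //.
  by rewrite eqxx addr0.
have cE : c = #|G|%:R / d%:R * (j == k)%:R.
  move: trA; rewrite Ac mxtrace_scalar => trA.
  by apply: (mulfI d0); rewrite [LHS]mulr_natl trA; field.
transitivity (A i l); last by rewrite Ac mxE cE -[LHS]mulr_natr.
rewrite /A summxE; apply: eq_bigr => s _.
rewrite mxE (bigD1 k) //= [X in _ = _ + X]big1 ?addr0 => [|h /negPf hk].
  rewrite mxE (bigD1 j) //= [X in _ = (_ + X) * _]big1 => [|h /negPf hj].
    by rewrite mxE !eqxx mulr1 addr0.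
  by rewrite mxE hj mulr0.
by rewrite mxE big1 ?mul0r // => m _; rewrite mxE hk andbF mulr0.
Qed.

(** * The unitary action of the group on the module *)

Section Translation.
Context {R : realType} {n : nat} {gT : finGroupType} {G : {group gT}}.
Context {rho : mx_representation R[i] G n} {Om : set 'cV[R[i]]_n}.
Context {H : submodClosed (cfun R n)} {dot : {dot (subsp H) for Num.conj}}.
Context {K : 'cV[R[i]]_n -> 'cV[R[i]]_n -> R[i]}.
Hypothesis Om_inv : invariant_set rho Om.
Hypothesis H_module : analytic_hilbert_module dot Om K.
Hypothesis K_inv : invariant_kernel rho Om K.

Lemma invariant_setE s z : s \in G -> Om (rho s *m z) <-> Om z.
Proof.
move=> sG; split=> Omz; last by rewrite -(Om_inv _ sG); exists z.
have sVG : s^-1%g \in G by rewrite groupV.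
by rewrite -(Om_inv _ sVG); exists (rho s *m z) => //;
  rewrite mulmxA -repr_mxM ?groupV // mulVg repr_mx1 mul1mx.
Qed.

Lemma module_sqn_complete (u : nat -> subsp H) :
  sqn_cauchy dot u -> exists f, sqn_cvg dot u f.
Proof.
have hsq (x : subsp H) (e : R[i]) :
    0 < e -> (hnorm dot x < e) = (dot x x < e ^+ 2).
  move=> e0; rewrite /hnorm -[in RHS](sqrtCK (dot x x)) ltr_pXn2r //.
  - by rewrite nnegrE sqrt_dnorm_ge0.
  - by rewrite nnegrE ltW.
move=> cu; have [|f fP] := ahm_complete H_module (u := u).
  move=> e e0; have [N HN] := cu _ (exprn_gt0 2 e0).
  by exists N => k l Nk Nl; rewrite hsq //; exact: HN.
exists f => e e0; have se0 : 0 < sqrtC e by rewrite sqrtC_gt0.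
move/cvgr0_norm_lt/(_ _ se0): fP => [N _ HN].
exists N => k /HN /=; rewrite ger0_norm ?sqrt_dnorm_ge0 // hsq //.
by rewrite sqrtCK.
Qed.

Lemma module_kernel w : Om w -> exists kw : subsp H,
  (forall z, Om z -> \val kw z = K z w) /\
  forall f : subsp H, \val f w = dot f kw.
Proof. by move=> /(ahm_kernel H_module)[k]; exists k. Qed.

Lemma module_out (f : subsp H) z : ~ Om z -> \val f z = 0.
Proof.
by move=> nz; rewrite -(ahm_restr H_module f) patchE memNset.
Qed.

(** Unitarity is expressed through inner products with all translates that lie
    in the module, because this condition is linear in [f], unlike preservation
    of the norm; for [h = f] and [h' = g] it gives preservation of the norm. *)
Definition translates_unitarily s (f : subsp H) : Prop :=
  exists g : subsp H, \val g = \val f \o mulmx (rho s) /\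
    forall h h' : subsp H, \val h' = \val h \o mulmx (rho s) ->
      dot g h' = dot f h.

(** The translate of the kernel function at [w] is the kernel function at
    [s^-1 w], and by the reproducing property inner products with these are
    values at [w] and at [s^-1 w]. *)
Lemma kernel_translates s (w : 'cV[R[i]]_n) (kw : subsp H) : s \in G -> Om w ->
  (forall z, Om z -> \val kw z = K z w) ->
  (forall f : subsp H, \val f w = dot f kw) ->
  translates_unitarily s kw.
Proof.
move=> sG Omw kwE kwP; pose w' := rho s^-1%g *m w.
have sw' : rho s *m w' = w.
  by rewrite mulmxA -repr_mxM ?groupV // mulgV repr_mx1 mul1mx.
have Omw' : Om w' by rewrite -(invariant_setE s) // sw'.
have [g [gE gP]] := module_kernel _ Omw'; exists g; split.
  apply/funext => z /=; have [Omz|nOmz] := pselect (Om z).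
    rewrite gE // kwE; last exact/invariant_setE.
    by rewrite -sw' K_inv.
  by rewrite !module_out // invariant_setE.
move=> h h' h'E; rewrite dot_conj -gP h'E /= sw' kwP.
by rewrite -dot_conj.
Qed.

(** Translation preserves distances on these functions, so the translates of a
    convergent sequence form a Cauchy sequence; its limit is the translate of
    the limit because evaluations are inner products with kernel functions. *)
Lemma translates_closed s (u : nat -> subsp H) f : s \in G ->
  (forall k, translates_unitarily s (u k)) -> sqn_cvg dot u f ->
  translates_unitarily s f.
Proof.
move=> sG /choice[v vP] uf.
have vE k := (vP k).1; have {vP}vP k := (vP k).2.
have [g vg] : exists g, sqn_cvg dot v g.
  apply: module_sqn_complete => e e0.
  have [N HN] := sqn_cvg_cauchy _ _ _ uf _ e0.
  exists N => k l Nk Nl; suff -> : dot (v k - v l) (v k - v l) =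
      dot (u k - u l) (u k - u l) by exact: HN.
  rewrite (dotBl dot (v k)) (dotBl dot (u k)); congr (_ - _); apply: vP;
    by rewrite !raddfB /= !vE.
exists g; split; last first.
  by move=> h h' hE; apply/esym/(dot_lim_unique _ _ _ _ _ _ _ uf vg) => k;
     rewrite (vP _ h).
apply/funext => z /=; have [Omz|nOmz] := pselect (Om z); last first.
  by rewrite !module_out // invariant_setE.
have Omsz : Om (rho s *m z) by exact/invariant_setE.
have [kz [_ kzP]] := module_kernel _ Omz.
have [ksz [_ kszP]] := module_kernel _ Omsz.
rewrite kzP kszP; apply: (dot_lim_unique _ _ _ _ _ _ _ vg uf) => k.
by rewrite -kzP -kszP vE.
Qed.

(** A function orthogonal to all kernel functions vanishes on [Om], hence is 0,
    so the projection theorem applies to the functions that translate well. *)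
Lemma all_translate_unitarily s f : s \in G -> translates_unitarily s f.
Proof.
move=> sG; move: f; apply: (closed_subspace_full dot).
- exact: module_sqn_complete.
- by exists 0; split=> [|h h' _]; [rewrite !raddf0|rewrite !linear0l].
- move=> u v [u' [uE uP]] [v' [vE vP]]; exists (u' + v'); split.
    by rewrite !raddfD /= uE vE.
  by move=> h h' hE; rewrite !linearDl /= (uP h) // (vP h).
- move=> a u [u' [uE uP]]; exists (a *: u'); split.
    by rewrite !linearZ /= uE.
  by move=> h h' hE; rewrite !linearZl_LR /= (uP h).
- by move=> u f; exact: translates_closed.
move=> f fperp; apply/val_inj/funext => z.
have [Omz|nOmz] := pselect (Om z); last by rewrite !module_out.
have [kz [kzE kzP]] := module_kernel _ Omz.
rewrite kzP fperp ?raddf0 //; exact: kernel_translates kzE kzP.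
Qed.

(** For [s \in G] the function passed to [insubd] belongs to [H], by
    [all_translate_unitarily]. *)
Definition translate s (f : subsp H) : subsp H :=
  insubd f (\val f \o mulmx (rho s)).

Lemma val_translate s f : s \in G ->
  \val (translate s f) = \val f \o mulmx (rho s).
Proof.
move=> sG; have [g [gE _]] := all_translate_unitarily s f sG.
by rewrite insubdK // -gE; exact: valP.
Qed.

Lemma dot_translate s f g : s \in G ->
  dot (translate s f) (translate s g) = dot f g.
Proof.
move=> sG; have [f' [f'E f'P]] := all_translate_unitarily s f sG.
rewrite -(f'P g (translate s g)) ?val_translate //; congr (dot _ _).
by apply/val_inj; rewrite f'E val_translate.
Qed.

Lemma dot_translateV s f g : s \in G ->
  dot (translate s^-1%g f) g = dot f (translate s g).
Proof.
move=> sG; rewrite -(dot_translate s (translate s^-1%g f) g) //.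
congr (dot _ _); apply/val_inj/funext => z.
rewrite val_translate //= val_translate ?groupV //=.
by rewrite mulmxA -repr_mxM ?groupV // mulVg repr_mx1 mul1mx.
Qed.

End Translation.

(** * The operator as a projection on functions *)

Section Projection.
Context {R : realType} {n : nat} {gT : finGroupType} {G : {group gT}}.
Context {rho : mx_representation R[i] G n}.
Context {d : nat} (pi : mx_representation R[i] G d).
Hypothesis pi_irr : mx_irreducible pi.
Hypothesis pi_unitary : unitary_repr pi.

Lemma isotypic_projE i f z : isotypic_proj rho pi i f z =
  d%:R / #|G|%:R * \sum_(s in G) pi s^-1%g i i * f (rho s^-1%g *m z).
Proof.
rewrite -[LHS]/(d%:R / #|G|%:R *
  (\sum_(s in G) pi s^-1%g i i *: (f \o mulmx (rho s^-1%g))) z).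
by rewrite fct_sumE.
Qed.

Lemma isotypic_proj_linear i a f g :
  isotypic_proj rho pi i (a *: f + g) =
  a *: isotypic_proj rho pi i f + isotypic_proj rho pi i g.
Proof.
apply/funext => z.
transitivity (a * isotypic_proj rho pi i f z + isotypic_proj rho pi i g z);
  last by [].
rewrite !isotypic_projE mulrCA -mulrDr; congr (_ * _).
rewrite mulr_sumr -big_split /=.
apply: eq_bigr => s _.
rewrite -[(a *: f + g) _]/(a * f (rho s^-1%g *m z) + g (rho s^-1%g *m z)).
by rewrite mulrDr mulrCA.
Qed.

(** Grouping the double sum by the product [u] of the two group elements, the
    coefficient of the translate by [u] is a convolution of matrix entries,
    which [schur_orthogonality] evaluates. *)
Lemma isotypic_proj_idem i f :
  isotypic_proj rho pi i (isotypic_proj rho pi i f) = isotypic_proj rho pi i f.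
Proof.
apply/funext => z; rewrite [LHS]isotypic_projE [RHS]isotypic_projE.
congr (_ * _).
have d0 : (d%:R : R[i]) != 0.
  by case/mx_irrP: pi_irr => d0 _; rewrite pnatr_eq0 -lt0n.
have G0 : (#|G|%:R : R[i]) != 0 by rewrite pnatr_eq0 -lt0n cardG_gt0.
transitivity (d%:R / #|G|%:R * \sum_(s in G) \sum_(u in G)
    pi s^-1%g i i * pi (u^-1 * s)%g i i * f (rho u^-1%g *m z)).
  rewrite mulr_sumr; apply: eq_bigr => s sG.
  rewrite isotypic_projE mulrCA; congr (_ * _).
  (* f is evaluated at t^-1 s^-1 z = u^-1 z for u = s t. *)
  rewrite mulr_sumr [RHS](reindex_inj (mulgI s)) /=.
  apply: eq_big => [t|t tG]; first by rewrite groupMl.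
  rewrite mulrA invMg mulgKV mulmxA repr_mxM ?groupV //.
rewrite exchange_big mulr_sumr /=; apply: eq_bigr => u uG.
rewrite -mulr_suml mulrA; congr (_ * _).
transitivity (d%:R / #|G|%:R * \sum_j pi u^-1%g i j *
    \sum_(s in G) pi s j i * pi s^-1%g i i).
  congr (_ * _); under [RHS]eq_bigr do rewrite mulr_sumr.
  rewrite [RHS]exchange_big /=; apply: eq_bigr => s sG.
  rewrite repr_mxM ?groupV // mxE mulr_sumr; apply: eq_bigr => j _.
  by rewrite mulrC mulrA.
rewrite (bigD1 i) //= [X in _ * (_ + X)]big1 ?addr0 => [|j /negPf ji].
  by rewrite schur_orthogonality // !eqxx !mulr1; field; rewrite d0 G0.
by rewrite schur_orthogonality // ji !mulr0.
Qed.

Lemma unitary_reprV i j s : s \in G -> pi s^-1%g i j = (pi s j i)^*.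
Proof.
move=> sG; have /invmx_unitary E := pi_unitary _ sG.
by rewrite repr_mxV // E !mxE.
Qed.

End Projection.

(** * Points with trivial stabilizer and interpolation *)

(** A nonempty open set is not covered by finitely many proper subspaces: the
    complement of one kernel is open, and a point of the kernel leaves it by an
    arbitrarily small move, so the matrices can be treated one at a time. *)
Lemma open_avoid_kernels (K : numFieldType) (n : nat) (U : set 'cV[K]_n)
    (As : seq 'M[K]_n) :
  open U -> U !=set0 -> {in As, forall A, A != 0} ->
  exists2 z, U z & {in As, forall A, A *m z != 0}.
Proof.
elim: As U => [|A As IH] U Uo [z0 Uz0] nz; first by exists z0.
have [i [j Aij]] : exists i j, A i j != 0.
  apply: contrapT => h; have /eqP := nz A (mem_head _ _); apply.
  apply/matrixP => i j; rewrite mxE; apply/eqP/negPn/negP => Aij.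
  by apply: h; exists i, j.
pose L (z : 'cV[K]_n) : K := (A *m z) i ord0.
have Lc : continuous L.
  have -> : L = fun z => \sum_j A i j * z j ord0.
    by apply/funext => z; rewrite /L mxE.
  elim: (index_enum _) => [|k r IHr].
    under eq_fun do rewrite big_nil; exact: cst_continuous.
  under eq_fun do rewrite big_cons.
  have tc : continuous (fun z : 'cV[K]_n => A i k * z k ord0).
    move=> z; apply: (@cvgMl_tmp K 'cV[K]_n (nbhs z) (nbhs_filter z)).
    exact: coord_continuous.
  by move=> z; exact: (@cvgD K _ 'cV[K]_n (nbhs z) (nbhs_filter z)
    _ _ _ _ (tc z) (IHr z)).
have [|||z [Uz Lz] zAs] := IH (U `&` L @^-1` (~` [set 0])).
- apply: openI => //; apply: open_comp; last first.
    apply/closed_openC/accessible_closed_set1/hausdorff_accessible.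
    exact: norm_hausdorff.
  by move=> z _; exact: Lc.
- have [L0|L0] := eqVneq (L z0) 0; last by exists z0; split => //; apply/eqP.
  have /nbhs_ballP[e /= e0 eU] : nbhs z0 U by exact: open_nbhs_nbhs.
  have e2 : 0 < e / 2 by rewrite divr_gt0.
  exists (z0 + (e / 2) *: delta_mx j ord0); split; last first.
  - rewrite /preimage /=.
    have -> : L (z0 + (e / 2) *: delta_mx j ord0) = L z0 + e / 2 * A i j.
      by rewrite /L mulmxDr mxE -scalemxAr -colE !mxE.
    by apply/eqP; rewrite L0 add0r mulf_neq0 // gt_eqF.
  - apply: eU; split => // a b; rewrite /ball /= !mxE opprD addrA subrr.
    rewrite sub0r normrN normrM gtr0_norm // normr_nat.
    apply: (@le_lt_trans _ _ (e / 2)).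
      by rewrite -[leRHS]mulr1 ler_pM2l // lern1 leq_b1.
    by rewrite ltr_pdivrMr // ltr_pMr // ltr1n.
- by move=> B Bs; apply: nz; rewrite inE Bs orbT.
exists z => // B; rewrite inE => /predU1P[->|]; last exact: zAs.
by apply/eqP => B0; apply: Lz; rewrite /L /= B0 mxE.
Qed.

Lemma open_trivial_stabilizer (R : realType) (n : nat) (gT : finGroupType)
    (G : {group gT}) (rho : mx_representation R[i] G n) (U : set 'cV[R[i]]_n) :
  mx_faithful rho -> open U -> U !=set0 ->
  exists2 z, U z & forall s, s \in G -> rho s *m z = z -> s = 1%g.
Proof.
move=> rhoF Uo U0.
have [|z Uz zP] := @open_avoid_kernels R[i] n U
    [seq rho s - 1%:M | s <- enum (G^#)%g] Uo U0.
  move=> _ /mapP[s + ->]; rewrite mem_enum => /setD1P[s1 sG]; rewrite subr_eq0.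
  apply: contraNneq s1 => rs1; have /fintype.subsetP/(_ s) := rhoF.
  by rewrite !inE sG rs1 mulmx1 eqxx; apply.
exists z => // s sG sz; apply/eqP/negPn/negP => s1.
have : rho s - 1%:M \in [seq rho s - 1%:M | s <- enum (G^#)%g].
  by apply/mapP; exists s => //; rewrite mem_enum !inE s1.
by move/zP; rewrite mulmxBl mul1mx sz subrr eqxx.
Qed.

Arguments open_trivial_stabilizer {R n gT G rho U}.

(** For each [w] in the list, one coordinate separates [z0] from [w] and gives an
    affine factor that is 1 at [z0] and 0 at [w]; the polynomial is the product
    of these factors. *)
Lemma interpolating_polynomial (R : realType) (n : nat) (z0 : 'cV[R[i]]_n)
    (ws : seq 'cV[R[i]]_n) : z0 \notin ws ->
  exists2 p : mpoly.mpoly n R[i], polyfun p z0 = 1 &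
    {in ws, forall w, polyfun p w = 0}.
Proof.
elim: ws => [_|w ws IH]; first by exists 1 => //; exact: mpoly.meval1.
rewrite inE negb_or => /andP[z0w /IH[p p1 p0]].
have [j zj] : exists j, z0 j ord0 != w j ord0.
  apply: contrapT => h; case/eqP: z0w; apply/matrixP => j k; rewrite ord1.
  by apply/eqP/negPn/negP => zj; apply: h; exists j.
pose q : mpoly.mpoly n R[i] := mpoly.mpolyC n (z0 j ord0 - w j ord0)^-1 *
  (mpoly.mpolyX R[i] (mpoly.mnm1 j) - mpoly.mpolyC n (w j ord0)).
have qE z : polyfun q z = (z0 j ord0 - w j ord0)^-1 * (z j ord0 - w j ord0).
  by rewrite /polyfun mpoly.mevalM mpoly.mevalB !mpoly.mevalC mpoly.mevalXU.
have pqE z : polyfun (p * q) z = polyfun p z * polyfun q z.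
  exact: mpoly.mevalM.
exists (p * q); first by rewrite pqE p1 qE mul1r mulVf // subr_eq0.
move=> v; rewrite inE pqE => /predU1P[->|vws]; first by rewrite qE subrr !mulr0.
by rewrite p0 // mul0r.
Qed.

(** * Orthogonality and nontriviality of the projections *)

Theorem corollary5p6 (R : realType) (n : nat)
    (gT : finGroupType) (G : {group gT}) (rho : mx_representation R[i] G n)
    (rho_faithful : mx_faithful rho)
    (rho_refl : pseudoreflection_group rho)
    (Om : set 'cV[R[i]]_n)
    (Om_domain : domain Om)
    (Om_bounded : bounded_set Om)
    (Om_inv : invariant_set rho Om)
    (H : submodClosed (cfun R n))
    (dot : {dot (subsp H) for Num.conj})
    (K : 'cV[R[i]]_n -> 'cV[R[i]]_n -> R[i])
    (H_module : analytic_hilbert_module dot Om K)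
    (K_inv : invariant_kernel rho Om K)
    (d : nat) (pi : mx_representation R[i] G d)
    (pi_irr : mx_irreducible pi)
    (pi_unitary : unitary_repr pi)
    (i : 'I_d) :
  exists P : {linear subsp H -> subsp H},
    [/\ forall f, \val (P f) = isotypic_proj rho pi i (\val f),
        orthogonal_projection dot P
      & range P <> [set 0]].
Proof.
have PH (f : subsp H) : isotypic_proj rho pi i (\val f) \in H.
  rewrite /isotypic_proj rpredZ // rpred_sum // => s sG; rewrite rpredZ //.
  rewrite -(val_translate Om_inv H_module K_inv) ?groupV //; exact: valP.
pose P0 (f : subsp H) : subsp H := Sub (isotypic_proj rho pi i (\val f)) (PH f).
have P0E f : \val (P0 f) = isotypic_proj rho pi i (\val f) by exact: SubK.
have P0lin : linear P0.
  move=> a f g; apply: val_inj.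
  transitivity (a *: \val (P0 f) + \val (P0 g)); last first.
    by rewrite raddfD /= linearZ.
  rewrite !P0E -isotypic_proj_linear; congr (isotypic_proj _ _ _ _).
pose P : {linear subsp H -> subsp H} :=
  HB.pack P0 (GRing.isLinear.Build _ _ _ _ P0 P0lin).
have PvalE f : \val (P f) = isotypic_proj rho pi i (\val f) by exact: P0E.
exists P; split=> //.
- split=> [f|f g].
    by apply: val_inj; rewrite !PvalE isotypic_proj_idem.
  have PE h : P h = (d%:R / #|G|%:R) *:
      \sum_(s in G) pi s^-1%g i i *: translate (rho := rho) s^-1%g h.
    apply: val_inj; rewrite PvalE /isotypic_proj [RHS]linearZ; congr (_ *: _).
    rewrite [RHS]raddf_sum; apply: eq_bigr => s sG.
    rewrite [RHS]linearZ; congr (_ *: _).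
    by apply/esym/(val_translate Om_inv H_module K_inv); rewrite groupV.
  rewrite !PE linearZl_LR linearZr_LR /=.
  have -> : (d%:R / #|G|%:R : R[i])^* = d%:R / #|G|%:R.
    by rewrite rmorphM fmorphV /= !conjC_nat.
  (* The adjoint of translation by s^-1 is translation by s, and pi s^-1 is the
     conjugate transpose of pi s: the two sums differ by inverting s. *)
  congr (_ * _); rewrite linear_sumlz linear_sumr /= (reindex_inj invg_inj) /=.
  apply: eq_big => [s|s]; rewrite groupV // => sG.
  rewrite linearZl_LR linearZr_LR /= -unitary_reprV ?groupV //.
  congr (_ * _); rewrite invgK -{1}(invgK s).
  by rewrite (dot_translateV Om_inv H_module K_inv) ?groupV.
(* The projection of p takes the value d / #|G| at z. *)
have [Om_open _ Om_ne] := Om_domain.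
have [z Omz zstab] := open_trivial_stabilizer rho_faithful Om_open Om_ne.
have [|p pz pw] := @interpolating_polynomial R n z
    [seq rho s *m z | s <- enum (G^#)%g].
  apply/mapP => -[s]; rewrite mem_enum => /setD1P[s1 sG] /esym/(zstab _ sG) s_1.
  by rewrite s_1 eqxx in s1.
pose q : subsp H := Sub (polyfun p \_ Om) (ahm_poly H_module p).
move=> rP; have : (range P) (P q) by exists q.
rewrite rP => Pq0.
have : \val (P q) z = 0 by rewrite (Pq0 : P q = 0) raddf0.
rewrite PvalE isotypic_projE (bigD1 1%g) //= big1 ?addr0 => [|s /andP[sG s1]].
  rewrite invg1 !repr_mx1 mul1mx patchE mem_set // pz mxE eqxx !mulr1.
  move/eqP; rewrite mulf_eq0 invr_eq0 !pnatr_eq0.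
  rewrite -[#|G| == 0%N]negbK -lt0n cardG_gt0 orbF.
  by case/mx_irrP: pi_irr => d0 _; rewrite -[d == 0%N]negbK -lt0n d0.
have sVG : s^-1%g \in G by rewrite groupV.
rewrite patchE mem_set ?pw ?mulr0 //.
  by apply/mapP; exists s^-1%g => //; rewrite mem_enum !inE invg_eq1 s1.
by apply/(invariant_setE Om_inv).
Qed.
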